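(* Let $n,f\in\mathbb{N}$ be such that $n\ge2$ and $f\le n-2$. Let $F=\{n-f,\dots,n-1\}$ if $f>0$ and $F=\emptyset$ if $f=0$, and let $A=(A_1,\dots,A_n)\in\mathcal{A}_n^F$. Let $\lambda>0$ and $\theta>0$, let $z_{i,0}\in\mathcal{H}$ for all $i\in\{1,\dots,n-1-f\}$, and for all $k\in\mathbb{N}$ let \begin{align*} x_{1,k}&=J_{\lambda A_1}z_{1,k},\\ x_{i,k}&=J_{\theta^{-1}\lambda A_i}(x_{1,k}+\theta^{-1}z_{i,k})&&\text{for all }i\in\{2,\dots,n-1-f\},\\ x_{i,k}&=\lambda A_ix_{1,k}&&\text{for all }i\in\{n-f,\dots,n-1\},\\ \bar x_k&=\sum_{j=n-f}^{n-1}x_{j,k}+\sum_{j=2}^{n-1-f}\bigl(z_{j,k}+\theta(x_{1,k}-x_{j,k})\bigr),\\ x_{n,k}&=J_{\lambda A_n}(2x_{1,k}-z_{1,k}-\bar x_k),\\ z_{i,k+1}&=z_{i,k}-\theta(x_{i,k}-x_{n,k})&&\text{for all }i\in\{1,\dots,n-1-f\}. \end{align*} If $\operatorname{zer}\sum_{i=1}^nA_i\ne\emptyset$, $A_i$ is $\beta_i$-cocoercive (with $\beta_i>0$) for all $i\in F$, and $$\frac{\lambda}{2}\sum_{i=n-f}^{n-1}\beta_i^{-1}<2-\theta(n-1-f),$$ then $x_{n,k}\rightharpoonup x^\star$ as $k\to\infty$ for some $x^\star\in\operatorname{zer}\sum_{i=1}^nA_i$.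
   Context: Throughout, $\mathcal{H}$ is a real Hilbert space with $\dim\mathcal{H}\ge2$ and $\mathbb{N}=\{0,1,2,\dots\}$. A set-valued operator $A\colon\mathcal{H}\to2^{\mathcal{H}}$ is called single-valued if $Ax$ is a singleton for every $x\in\mathcal{H}$, and is then identified with a map. $\mathcal{A}_n^F$ is the set of tuples $(A_1,\dots,A_n)$ where every $A_i\colon\mathcal{H}\to2^{\mathcal{H}}$ is maximally monotone and $A_i$ is single-valued for all $i\in F$. $J_A=(\mathrm{Id}+A)^{-1}$ is the resolvent and $\operatorname{zer}A=\{x:0\in Ax\}$. An operator $A$ is $\beta$-cocoercive if it is single-valued and $\langle Ax-Ay,x-y\rangle\ge\beta\|Ax-Ay\|^2$ for all $x,y\in\mathcal{H}$. $\rightharpoonup$ denotes weak convergence. Empty sums are zero and index sets $\{a,\dots,b\}$ with $b<a$ are empty. *)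

(* Defs.v *)
From mathcomp Require Export all_boot all_order all_algebra.
From mathcomp Require Export boolp classical_sets functions reals topology normedtype sequences.

Set Implicit Arguments.
Unset Strict Implicit.
Unset Printing Implicit Defensive.

Import Order.TTheory GRing.Theory Num.Theory.
Import numFieldNormedType.Exports.

Local Open Scope classical_set_scope.
Local Open Scope ring_scope.

(* A real Hilbert space is a complete normed module [H] over the reals together
   with an inner product [ip : {dot H for idfun}] (symmetric, bilinear, positive
   definite) that induces the norm of [H]. *)
Definition induces_norm (R : realType) (H : normedModType R)
    (ip : {dot H for idfun}) : Prop :=
  forall x : H, `|x| = Num.sqrt (ip x x).

Definition dim_ge2 (R : realType) (H : lmodType R) : Prop :=
  exists u v : H, forall a b : R, a *: u + b *: v = 0 -> a = 0 /\ b = 0.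

(* Set-valued operators H -> 2^H are functions [A : H -> set H]; the library
   predicate [is_totalfun A] says that every [A x] is a singleton. *)
Section Operators.
Context (R : realType) (H : normedModType R) (ip : {dot H for idfun}).
Implicit Types (A B : H -> set H) (c : R) (x : H).

Definition monotone A : Prop :=
  forall x y u v, A x u -> A y v -> 0 <= ip (u - v) (x - y).

Definition maximally_monotone A : Prop :=
  monotone A /\
  forall B, monotone B -> (forall x, A x `<=` B x) -> forall x, B x `<=` A x.

Definition cocoercive (beta : R) A : Prop :=
  is_totalfun A /\
  forall x y u v, A x u -> A y v ->
    beta * `|u - v| ^+ 2 <= ip (u - v) (x - y).

Definition scaleop c A : H -> set H := fun x => [set c *: u | u in A x].

Definition inverseop A : H -> set H := fun y => [set x | A x y].

Definition resolvent A : H -> set H :=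
  inverseop (fun x => [set x + u | u in A x]).

(* Pointwise Minkowski sum of A_1, ..., A_n. *)
Definition sumop (n : nat) (A : nat -> H -> set H) : H -> set H :=
  fun x => [set s | exists u : nat -> H,
    (forall i, (1 <= i <= n)%N -> A i x (u i)) /\
    s = \sum_(1 <= i < n.+1) u i].

Definition zer A : set H := [set x | A x 0].

(* Tuples (A_1, ..., A_n) are families indexed by nat of which only the entries
   1, ..., n matter. *)
Definition class_AnF (n : nat) (F : set nat) (A : nat -> H -> set H) : Prop :=
  (forall i, (1 <= i <= n)%N -> maximally_monotone (A i)) /\
  (forall i, F i -> is_totalfun (A i)).

Definition weakly_cvg (u : nat -> H) x : Prop :=
  forall y : H, ip (u k) y @[k --> \oo] --> ip x y.

(* [is_value A x y]: A is single-valued at [x] with value [y]; this is how an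
   equation "y = A x" for an operator identified with a map is rendered. *)
Definition is_value A x (y : H) : Prop := A x = [set y].

End Operators.

Definition indexF (n f : nat) : set nat :=
  if (0 < f)%N then [set i | (n - f <= i <= n - 1)%N] else set0.

(* Main.v *)
Require Import Defs.
From mathcomp Require Import ring lra zify.

Set Implicit Arguments.
Unset Strict Implicit.
Unset Printing Implicit Defensive.

Import Order.TTheory GRing.Theory Num.Theory.
Import numFieldNormedType.Exports.

Local Open Scope classical_set_scope.
Local Open Scope ring_scope.

(** Replace every A_i by B_i = lam A_i, which keeps the zeros of the sum, and put
  p = n - f. Every line of the iteration selects an element a_i of some B_i:
  at x_1 for i = 1 and for the forward steps p <= i < n, at x_i otherwise, and
  the definition of x_n amounts to the balance sum_i a_i = x_1 - x_n. So x_1 and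
  the a_i solve the inclusion up to the residuals x_1 - x_i with 2 <= i < p or
  i = n, and the proof shows that these tend to 0.

  Descent. Let y be a zero of the sum, with b_i in B_i y and sum_i b_i = 0. The
  governing variables (z_1, ..., z_(p-1)) are compared with the fixed point
  s = (y + b_1, b_2, ..., b_(p-1)). Expanding the squares and adding the
  monotonicity inequalities of all the B_i, the terms in x_n add up through the
  balance to a multiple of the squared norm of x_1 - x_n, and the cross terms of
  the forward steps are absorbed by cocoercivity. What is left ([descent]) is
  that sum_i |z_i - s_i|^2 decreases by at least
  rate |x_1 - x_n|^2 + theta^2 sum_i |x_1 - x_i|^2, the last sum over
  2 <= i < p, where the condition on the parameters says exactly that rate > 0.
  So the residuals tend to 0, all sequences are bounded, and the distance of z to
  every fixed point converges.

  Weak limits. Along an ultrafilter on the indices every bounded sequence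
  converges weakly ([ultra_bounded_weak_cvg], by compactness of segments and the
  Riesz representation [riesz]), so no subsequence has to be extracted.
  Along each ultrafilter finer than the tails, the limits of x_1 and the a_i
  solve the inclusion again: this is demiclosedness [demiclosed_sum], which needs
  the residuals to tend strongly to 0. By Opial's argument
  [opial_uniqueness] two ultrafilters produce the same fixed point s, hence the
  same zero y, since y is the resolvent of B_1 at s_1. A scalar sequence that has
  the same limit along all these ultrafilters converges ([cvg_ultra]), and x_n
  has the same weak limits as x_1. *)

(** * Inner products *)

Section InnerProduct.
Context (R : realType) (H : completeNormedModType R) (ip : {dot H for idfun}).
Context (ip_norm : induces_norm ip).
Implicit Types (x y z : H) (c : R).

Lemma ipC x y : ip x y = ip y x.
Proof. by have := hermC ip x y; rewrite expr0 mul1r. Qed.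

Lemma ipDl x y z : ip (x + y) z = ip x z + ip y z.
Proof. exact: linearDl. Qed.

Lemma ipDr x y z : ip z (x + y) = ip z x + ip z y.
Proof. exact: linearDr. Qed.

Lemma ipNl x z : ip (- x) z = - ip x z.
Proof. exact: linearNl. Qed.

Lemma ipNr x z : ip z (- x) = - ip z x.
Proof. exact: linearNr. Qed.

Lemma ipZl c x z : ip (c *: x) z = c * ip x z.
Proof. exact: linearZl_LR. Qed.

Lemma ipZr c x z : ip z (c *: x) = c * ip z x.
Proof. by rewrite ipC ipZl ipC. Qed.

Lemma ip0l z : ip 0 z = 0.
Proof. exact: linear0l. Qed.

Lemma ip0r z : ip z 0 = 0.
Proof. by rewrite ipC ip0l. Qed.

Definition ipE := (ipDl, ipDr, ipNl, ipNr, ipZl, ipZr, ip0l, ip0r).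

Lemma ip_suml (I : Type) (r : seq I) (P : pred I) (u : I -> H) z :
  ip (\sum_(i <- r | P i) u i) z = \sum_(i <- r | P i) ip (u i) z.
Proof.
by apply: (big_morph (fun v => ip v z)) => [x y|]; rewrite ?ipDl ?ip0l.
Qed.

Lemma ip_sumr (I : Type) (r : seq I) (P : pred I) (u : I -> H) z :
  ip z (\sum_(i <- r | P i) u i) = \sum_(i <- r | P i) ip z (u i).
Proof. by rewrite ipC ip_suml; apply: eq_bigr => i _; rewrite ipC. Qed.

Lemma ip_ge0 x : 0 <= ip x x.
Proof.
case: (lerP 0 (ip x x)) => // xx_lt0.
have /eqP : `|x| = 0 by rewrite ip_norm ler0_sqrtr ?ltW.
by rewrite normr_eq0 => /eqP x0; rewrite x0 ip0l ltxx in xx_lt0.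
Qed.

Lemma normip x : `|x| ^+ 2 = ip x x.
Proof. by rewrite ip_norm sqr_sqrtr ?ip_ge0. Qed.

Lemma ip_self_inj x y : ip (x - y) (x - y) <= 0 -> x = y.
Proof.
rewrite -normip => h; apply/eqP; rewrite -subr_eq0 -normr_eq0 -sqrf_eq0.
by rewrite eq_le h sqr_ge0.
Qed.

(** The Gram determinant of x and y, up to a factor <y, y>, is the squared norm
  of <y, y> x - <x, y> y. *)
Lemma cauchy_schwarz x y : `|ip x y| <= `|x| * `|y|.
Proof.
rewrite -ler_sqr ?nnegrE ?mulr_ge0 // exprMn !normip real_normK ?num_real //.
have [->|y0] := eqVneq y 0; first by rewrite !ip0r expr0n mulr0.
have yy0 : 0 < ip y y by rewrite -normip exprn_gt0 ?normr_gt0.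
suff : 0 <= ip y y * (ip x x * ip y y - ip x y ^+ 2).
  by rewrite pmulr_rge0 // subr_ge0.
apply: le_trans (ip_ge0 (ip y y *: x - ip x y *: y)) _.
by rewrite !ipE (ipC y x) le_eqVlt; apply/orP; left; apply/eqP; ring.
Qed.

Lemma ip_le x y : ip x y <= `|x| * `|y|.
Proof. exact: le_trans (ler_norm _) (cauchy_schwarz x y). Qed.

(** * Limits of scalar products and the Riesz representation *)

Lemma cvg_ge0 (T : Type) (F : set_system T) {FF : ProperFilter F} (f : T -> R)
  (a : R) : f t @[t --> F] --> a -> (forall t, 0 <= f t) -> 0 <= a.
Proof.
move=> fa f0; rewrite -(cvg_lim _ fa) //.
by apply: limr_ge; [apply/cvg_ex; exists a | apply: filterE].
Qed.

Lemma cvg_bound0 (T : Type) (F : set_system T) {FF : Filter F} (f g : T -> R)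
  (C : R) : (forall t, `|f t| <= C * g t) -> g t @[t --> F] --> (0 : R) ->
  f t @[t --> F] --> (0 : R).
Proof.
move=> fg g0; apply: norm_cvg0.
apply: (@squeeze_cvgr _ _ _ _ (fun=> 0) (fun t => C * g t)).
- by apply: filterE => t; rewrite normr_ge0 fg.
- exact: cvg_cst.
- by rewrite -(mulr0 C); apply: cvgMl_tmp.
Qed.

Lemma cvg_ipl (T : Type) (F : set_system T) {FF : Filter F} (u : T -> H) x y :
  u t @[t --> F] --> x -> ip (u t) y @[t --> F] --> ip x y.
Proof.
move=> ux; apply/subr_cvg0; apply: (@cvg_bound0 _ _ _ _ (fun t => `|u t - x|) `|y|).
  by move=> t; rewrite -ipNl -ipDl mulrC cauchy_schwarz.
by apply/norm_cvg0P/subr_cvg0.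
Qed.

(** The representing vector is the minimizer of J x = <x, x> - 2 l x: by the
  parallelogram identity a minimizing sequence is Cauchy, and optimality to
  first order at its limit is the equation l = <u, .>. *)
Lemma riesz (l : H -> R) (C : R) :
  (forall x y, l (x + y) = l x + l y) -> (forall c x, l (c *: x) = c * l x) ->
  (forall x, `|l x| <= C * `|x|) -> exists u, forall y, l y = ip u y.
Proof.
move=> lD lZ lC.
pose J x := ip x x - 2 * l x.
pose E := range J.
(* complete the square, after bounding l x by C |x| *)
have lbJ x : - C ^+ 2 <= J x.
  rewrite /J -normip; have := le_trans (ler_norm _) (lC x).
  have := sqr_ge0 (`|x| - C); nra.
have Einf : has_inf E.
  by split; [exists (J 0), 0 | exists (- C ^+ 2) => _ [x _ <-]; exact: lbJ].
set m := inf E.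
have mJ x : m <= J x by apply: ge_inf; [case: Einf | exists x].
have /choice[y yP] : forall n : nat, exists x, J x < m + harmonic n.
  by move=> n; have [_ [x _ <-] ?] := inf_adherent (harmonic_gt0 n) Einf; exists x.
have J_half a b :
    ip (a - b) (a - b) = 2 * J a + 2 * J b - 4 * J (2^-1 *: (a + b)).
  by rewrite /J lZ lD !ipE (ipC b a); field.
have y_close i j : `|y i - y j| ^+ 2 <= 2 * harmonic i + 2 * harmonic j.
  rewrite normip J_half; have := mJ (2^-1 *: (y i + y j)).
  have := yP i; have := yP j; lra.
have y_cauchy : cauchy (y @ \oo).
  apply: cauchy_exP => e e0.
  have e4 : 0 < e ^+ 2 / 4 by rewrite divr_gt0 ?exprn_gt0.
  have [N _ NP] := cvgr0_norm_lt _ (@cvg_harmonic R) _ e4.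
  exists (y N); exists N => // k /= Nk; rewrite -ball_normE /=.
  rewrite -ltr_sqr ?nnegrE ?(ltW e0) //.
  have yNk := y_close N k; apply: le_lt_trans yNk _.
  have := NP N (leqnn _); have := NP k Nk.
  by rewrite !ger0_norm ?harmonic_ge0 //; lra.
have /cvg_ex[u yu] : cvg (y @ \oo) by exact/cauchy_cvgP.
exists u => v.
(* first-order optimality of the minimizer u in the direction v *)
have opt t : 0 <= 2 * t * (ip u v - l v) + t ^+ 2 * ip v v.
  have cvg_opt : harmonic n + 2 * t * (ip (y n) v - l v) + t ^+ 2 * ip v v
      @[n --> \oo] --> 0 + 2 * t * (ip u v - l v) + t ^+ 2 * ip v v.
    apply: cvgD; last exact: cvg_cst.
    apply: cvgD; first exact: cvg_harmonic.
    by apply: cvgMl_tmp; apply: cvgB; [exact: cvg_ipl|exact: cvg_cst].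
  rewrite -[X in X + _]add0r; apply: (cvg_ge0 cvg_opt) => n.
  have := mJ (y n + t *: v); have := yP n.
  by rewrite /J lD lZ !ipE (ipC v); lra.
(* the step that minimizes the quadratic for <v, v> + 1 in place of <v, v>,
   a positive number whatever v is *)
have := opt (- (ip u v - l v) / (ip v v + 1)).
have vv : 0 < ip v v + 1 by rewrite ltr_wpDl ?ip_ge0.
set a := ip u v - l v; set b := ip v v => h.
have : 0 <= - a ^+ 2 * (b + 2).
  have -> : - a ^+ 2 * (b + 2) = (2 * (- a / (b + 1)) * a +
    (- a / (b + 1)) ^+ 2 * b) * (b + 1) ^+ 2 by field; rewrite gt_eqF.
  by rewrite mulr_ge0 ?sqr_ge0.
rewrite pmulr_lge0 ?oppr_ge0; last by rewrite ltr_wpDl ?ip_ge0.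
rewrite le_eqVlt ltNge sqr_ge0 orbF sqrf_eq0 subr_eq0 => /eqP uv.
by rewrite uv.
Qed.

(** * Weak limits along ultrafilters *)

Definition bounded_seq (u : nat -> H) : Prop := exists M, forall k, `|u k| <= M.

Definition weak_cvg_along (F : set_system nat) (u : nat -> H) (x : H) : Prop :=
  forall y, ip (u k) y @[k --> F] --> ip x y.

(** The image filter has a cluster point by compactness of the segment, and an
  ultrafilter converges to each of its cluster points. *)
Lemma ultra_bounded_cvg (U : set_system nat) (UU : UltraFilter U)
  (f : nat -> R) (C : R) : (forall k, `|f k| <= C) ->
  exists a : R, f k @[k --> U] --> a.
Proof.
move=> fC; have UP : ProperFilter U := @ultra_proper _ U UU.
have segC : U (f @^-1` `[- C, C]%classic).
  by apply: filterE => k; rewrite /= in_itv /= -ler_norml.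
have [a [_ aU]] := segment_compact (fmap_proper_filter f UP) segC.
exists a => B Ba; have [//|UnB] := in_ultra_setVsetC (f @^-1` B) UU.
by have [b [nBb Bb]] := aU (~` B) B UnB Ba.
Qed.

(** The limits of <u k, y> along U depend on y as a bounded linear functional,
  and its Riesz representative is the weak limit. *)
Lemma ultra_bounded_weak_cvg (U : set_system nat) (UU : UltraFilter U)
  (u : nat -> H) : bounded_seq u -> exists x, weak_cvg_along U u x.
Proof.
move=> [M uM]; have UP : ProperFilter U := @ultra_proper _ U UU.
have ipM k y : `|ip (u k) y| <= M * `|y|.
  by apply: le_trans (cauchy_schwarz _ _) _; rewrite ler_wpM2r.
have /choice[l lP] : forall y, exists a : R, ip (u k) y @[k --> U] --> a.
  by move=> y; apply: ultra_bounded_cvg (ipM^~ y).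
have l_uniq y a : ip (u k) y @[k --> U] --> a -> l y = a.
  by move=> ua; apply: cvg_unique (lP y) ua.
have lD y w : l (y + w) = l y + l w.
  by apply: l_uniq; under eq_fun do rewrite ipDr; apply: cvgD.
have lZ c y : l (c *: y) = c * l y.
  by apply: l_uniq; under eq_fun do rewrite ipZr; apply: cvgMl_tmp.
have lM y : `|l y| <= M * `|y|.
  rewrite -subr_ge0; apply: (@cvg_ge0 _ U _ (fun k => M * `|y| - `|ip (u k) y|)).
    by apply: cvgB; [exact: cvg_cst|apply: cvg_norm].
  by move=> k; rewrite subr_ge0.
by have [x xP] := riesz lD lZ lM; exists x => y; rewrite -xP.
Qed.

Lemma bounded_seqD u v : bounded_seq u -> bounded_seq v ->
  bounded_seq (fun k => u k + v k).
Proof.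
move=> [M uM] [N vN]; exists (M + N) => k.
exact: le_trans (ler_normD _ _) (lerD (uM k) (vN k)).
Qed.

Lemma bounded_seqZ c u : bounded_seq u -> bounded_seq (fun k => c *: u k).
Proof. by move=> [M uM]; exists (`|c| * M) => k; rewrite normrZ ler_wpM2l. Qed.

Lemma bounded_seqB u v : bounded_seq u -> bounded_seq v ->
  bounded_seq (fun k => u k - v k).
Proof.
move=> ub [N vN]; apply: bounded_seqD => //; exists N => k.
by rewrite normrN.
Qed.

Lemma bounded_seq_cst x : bounded_seq (fun=> x).
Proof. by exists `|x|. Qed.

Lemma bounded_seq_sum (I : eqType) (r : seq I) (u : I -> nat -> H) :
  (forall i, i \in r -> bounded_seq (u i)) ->
  bounded_seq (fun k => \sum_(i <- r) u i k).
Proof.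
move=> ub; have /choice[M uM] : forall i, exists M, i \in r ->
    forall k, `|u i k| <= M.
  move=> i; have [ir|_] := boolP (i \in r); last by exists 0.
  by have [M] := ub i ir; exists M.
exists (\sum_(i <- r | i \in r) M i) => k.
rewrite big_seq; apply: le_trans (ler_norm_sum _ _ _) _.
by apply: ler_sum => i ir; exact: uM.
Qed.

Lemma bounded_seq_sqr (C : R) u : (forall k, `|u k| ^+ 2 <= C) -> bounded_seq u.
Proof.
move=> uC; exists (1 + C) => k; have := uC k; have := sqr_ge0 (`|u k| - 1).
by nra.
Qed.

(** If f left a neighbourhood B of a infinitely often, an ultrafilter containing
  both the tails and the indices where f is outside B would contradict the
  hypothesis. This turns uniqueness of weak cluster points into weak
  convergence. *)
Lemma cvg_ultra (f : nat -> R) (a : R) :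
  (forall U, UltraFilter U -> \oo `<=` U -> f k @[k --> U] --> a) ->
  f k @[k --> \oo] --> a.
Proof.
move=> fa B Ba; apply: contrapT => nB.
pose G := within (~` (f @^-1` B)) \oo.
have GP : ProperFilter G.
  apply: (@Build_ProperFilter_ex _ G _ (within_filter _ _)) => P GP.
  apply: contrapT => /forallNP nP.
  apply: nB; change (\oo (f @^-1` B)); rewrite /G /within /= in GP.
  by apply: filterS GP => k PnB; apply: contrapT => nBk; apply: (nP k (PnB nBk)).
have [U [UU GU]] := ultraFilterLemma GP.
have UP : ProperFilter U := @ultra_proper _ U UU.
have ooU : \oo `<=` U.
  move=> P Poo; apply: GU; rewrite /G /within /=.
  by apply: filterS Poo => k Pk _.
have UB : U (f @^-1` B) by exact: (fa U UU ooU).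
have UnB : U (~` (f @^-1` B)) by apply: GU; exact: withinT.
by have [k []] := filter_ex (filterI UB UnB).
Qed.
End InnerProduct.

(** * Demiclosedness for sums of maximally monotone operators *)

Section Operators.
Context (R : realType) (H : completeNormedModType R) (ip : {dot H for idfun})
  (ip_norm : induces_norm ip).
Implicit Types (x y z : H) (c : R).

(** Adding the pair (x, u) to the graph of A keeps it monotone. *)
Lemma maximally_monotone_in (A : H -> set H) x u :
  maximally_monotone ip A ->
  (forall y v, A y v -> 0 <= ip (u - v) (x - y)) -> A x u.
Proof.
move=> [Amon Amax] xu; pose B y := A y `|` [set v | y = x /\ v = u].
suff Bmon : monotone ip B.
  by apply: (Amax B) => [//|y|]; [exact: subsetUl | right].
move=> y y' v v' [Ayv|[-> ->]] [Ayv'|[-> ->]].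
- exact: Amon.
- by rewrite -(opprB u) -(opprB x) ipNl ipNr opprK; exact: xu.
- exact: xu.
- by rewrite !subrr ip0l.
Qed.

(** When (x, u) is outside the graph, maximality gives a point with a negative
  pairing; when it is inside, the point (x, u) itself has pairing 0. Choosing one
  such point for each term of a sum, a nonnegative total of the pairings puts
  all the pairs in their graphs at once. *)
Lemma graph_test_point (A : H -> set H) x u : maximally_monotone ip A ->
  exists b : H * H, [/\ A b.1 b.2, ip (u - b.2) (x - b.1) <= 0 &
    ip (u - b.2) (x - b.1) = 0 -> A x u].
Proof.
move=> Amax; have [Axu|nAxu] := pselect (A x u).
  by exists (x, u); rewrite /= !subrr ip0l.
have : ~ forall y v, A y v -> 0 <= ip (u - v) (x - y).
  by move=> h; apply: nAxu; exact: maximally_monotone_in h.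
move=> /existsNP[y /existsNP[v /not_implyP[Ayv /negP]]]; rewrite -ltNge => neg.
by exists (y, v) => /=; split=> // [|e0]; [exact: ltW | rewrite e0 ltxx in neg].
Qed.

Lemma cvg_bigsum (T : Type) (F : set_system T) {FF : Filter F} (I : eqType)
    (r : seq I) (f : I -> T -> R) (a : I -> R) :
  (forall i, i \in r -> f i t @[t --> F] --> a i) ->
  \sum_(i <- r) f i t @[t --> F] --> \sum_(i <- r) a i.
Proof.
move=> fa; rewrite big_seq; under eq_fun do rewrite big_seq.
by apply: cvg_big => //; exact: add_continuous.
Qed.

(** The pairing of weakly convergent sequences does not pass to the limit in
  general. Here the sum of all the <u_i, w_i> does: it equals
  <sum_i u_i, p> up to the pairings with w_i - p, and both parts pair a bounded
  sequence with one that tends strongly to 0. So the sum of the monotonicity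
  inequalities against any points of the graphs passes to the limit, and
  [graph_test_point] provides the points that make it conclusive. *)
Lemma demiclosed_sum (F : set_system nat) {FF : ProperFilter F} (I : eqType)
    (r : seq I) (A : I -> H -> set H) (w u : I -> nat -> H) (p : nat -> H)
    (x : H) (v : I -> H) :
  (forall i, i \in r -> maximally_monotone ip (A i)) ->
  (forall i k, i \in r -> A i (w i k) (u i k)) ->
  (forall i, i \in r -> bounded_seq (u i)) -> bounded_seq p ->
  (forall i, i \in r -> w i k - p k @[k --> F] --> (0 : H)) ->
  \sum_(i <- r) u i k @[k --> F] --> (0 : H) ->
  weak_cvg_along ip F p x ->
  (forall i, i \in r -> weak_cvg_along ip F (u i) (v i)) ->
  (forall i, i \in r -> A i x (v i)) /\ \sum_(i <- r) v i = 0.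
Proof.
move=> Amax Awu uM [Mp pM] wp u0 px uv.
have v0 y : ip (\sum_(i <- r) v i) y = 0.
  have uv_sum : ip (\sum_(i <- r) u i k) y @[k --> F] --> ip (\sum_(i <- r) v i) y.
    rewrite ip_suml; under eq_fun do rewrite ip_suml.
    by apply: cvg_bigsum => i ir; exact: uv.
  have u_sum0 : ip (\sum_(i <- r) u i k) y @[k --> F] --> (0 : R).
    by rewrite -(ip0l ip y); exact: cvg_ipl.
  exact: cvg_unique uv_sum u_sum0.
split; last first.
  by apply: (ip_self_inj ip_norm); rewrite subr0 v0.
have wx i : i \in r -> weak_cvg_along ip F (w i) x.
  move=> ir y; have -> : ip x y = 0 + ip x y by rewrite add0r.
  under eq_fun => k do rewrite -(subrK (p k) (w i k)) ipDl.
  by apply: cvgD; [rewrite -(ip0l ip y); apply: cvg_ipl => //; exact: wp | exact: px].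
have uw0 : \sum_(i <- r) ip (u i k) (w i k) @[k --> F] --> (0 : R).
  have E k : \sum_(i <- r) ip (u i k) (w i k) =
      \sum_(i <- r) ip (u i k) (w i k - p k) + ip (\sum_(i <- r) u i k) (p k).
    rewrite ip_suml -big_split /=; apply: eq_bigr => i _.
    by rewrite -ipDr subrK.
  under eq_fun do rewrite E.
  have lim0 : \sum_(i <- r) (0 : R) + 0 = 0 by rewrite big1 ?addr0.
  suff : (\sum_(i <- r) ip (u i k) (w i k - p k) + ip (\sum_(i <- r) u i k) (p k))
    @[k --> F] --> \sum_(i <- r) (0 : R) + 0 by rewrite lim0.
  apply: cvgD.
    apply: cvg_bigsum => i ir; have [M uiM] := uM i ir.
    apply: (@cvg_bound0 _ _ _ _ _ (fun k => `|w i k - p k|) M) => [k|].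
      by apply: le_trans (cauchy_schwarz ip_norm _ _) _; rewrite ler_wpM2r ?uiM.
    by apply/norm_cvg0P; exact: wp.
  apply: (@cvg_bound0 _ _ _ _ _ (fun k => `|\sum_(i <- r) u i k|) Mp) => [k|].
    apply: le_trans (cauchy_schwarz ip_norm _ _) _.
    by rewrite mulrC ler_wpM2r.
  exact/norm_cvg0P.
have /choice[b bP] : forall i, exists b : H * H, i \in r ->
    [/\ A i b.1 b.2, ip (v i - b.2) (x - b.1) <= 0 &
        ip (v i - b.2) (x - b.1) = 0 -> A i x (v i)].
  move=> i; have [ir|_] := boolP (i \in r); last by exists 0.
  by have [b bP] := graph_test_point x (v i) (Amax i ir); exists b.
(* pairing of the limit (x, v i) with its test point *)
pose g i := ip (v i - (b i).2) (x - (b i).1).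
have g_ge0 : 0 <= \sum_(i <- r) g i.
  pose f i k := ip (u i k) (w i k) + (ip (b i).2 (b i).1
    - ip (w i k) (b i).2 - ip (u i k) (b i).1).
  have -> : \sum_(i <- r) g i = ip (\sum_(i <- r) v i) x +
      \sum_(i <- r) (ip (b i).2 (b i).1 - ip x (b i).2 - ip (v i) (b i).1).
    rewrite ip_suml -big_split /=; apply: eq_bigr => i _.
    by rewrite /g !ipE (ipC ip (b i).2 x); ring.
  rewrite v0; apply: (@cvg_ge0 _ _ F _ (fun k => \sum_(i <- r) f i k)).
    under eq_fun do rewrite /f big_split /=.
    apply: cvgD => //; apply: cvg_bigsum => i ir.
    by apply: cvgB; [apply: cvgB; [exact: cvg_cst | exact: wx] | exact: uv].
  move=> k; rewrite big_seq; apply: sumr_ge0 => i ir.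
  have -> : f i k = ip (u i k - (b i).2) (w i k - (b i).1).
    by rewrite /f !ipE (ipC ip (w i k)); ring.
  have [Amon _] := Amax i ir; have [Ab _ _] := bP i ir.
  exact: Amon (Awu i k ir) Ab.
have : \sum_(i <- r | i \in r) - g i == 0.
  rewrite eq_le; apply/andP; split; last first.
    by apply: sumr_ge0 => i ir; rewrite oppr_ge0; case: (bP i ir).
  by rewrite -big_seq sumrN oppr_le0.
rewrite psumr_eq0 => [/allP g0 i ir|i ir]; last first.
  by rewrite oppr_ge0; case: (bP i ir).
have [_ _] := bP i ir; apply.
by have := g0 i ir; rewrite ir oppr_eq0 => /eqP.
Qed.

(** The difference of the two squared distances is affine in z with linear part
  given by t - s, so the sum of the <z_i, t_i - s_i> converges; computing its
  limit along F and along G shows that |t - s|^2 = 0. *)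
Lemma opial_uniqueness (F G : set_system nat) {FF : ProperFilter F}
    {FG : ProperFilter G} (I : eqType) (r : seq I) (z : I -> nat -> H)
    (s t : I -> H) :
  \oo `<=` F -> \oo `<=` G ->
  cvgn (fun k => \sum_(i <- r) `|z i k - s i| ^+ 2) ->
  cvgn (fun k => \sum_(i <- r) `|z i k - t i| ^+ 2) ->
  (forall i, i \in r -> weak_cvg_along ip F (z i) (s i)) ->
  (forall i, i \in r -> weak_cvg_along ip G (z i) (t i)) ->
  forall i, i \in r -> s i = t i.
Proof.
move=> ooF ooG /cvg_ex[a za] /cvg_ex[b zb] zs zt.
pose g k := \sum_(i <- r) ip (z i k) (t i - s i).
pose c := 2^-1 * (a - b - \sum_(i <- r) (`|s i| ^+ 2 - `|t i| ^+ 2)).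
have gc : g k @[k --> \oo] --> c.
  have -> : g = fun k => 2^-1 * (\sum_(i <- r) `|z i k - s i| ^+ 2 -
    \sum_(i <- r) `|z i k - t i| ^+ 2 - \sum_(i <- r) (`|s i| ^+ 2 - `|t i| ^+ 2)).
    apply/funext => k; rewrite -!sumrB mulr_sumr; apply: eq_bigr => i _.
    by rewrite !(normip ip_norm) !ipE (ipC ip (s i) (z i k))
      (ipC ip (t i) (z i k)); field.
  apply: cvgMl_tmp; apply: cvgB; [exact: cvgB | exact: cvg_cst].
have lim_c (K : set_system nat) (KK : ProperFilter K) (q : I -> H) : \oo `<=` K ->
    (forall i, i \in r -> weak_cvg_along ip K (z i) (q i)) ->
    c = \sum_(i <- r) ip (q i) (t i - s i).
  move=> ooK zq; have gcK : g k @[k --> K] --> c by move=> B Bc; apply: ooK; exact: gc.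
  have gq : g k @[k --> K] --> \sum_(i <- r) ip (q i) (t i - s i).
    by apply: cvg_bigsum => i ir; exact: zq.
  exact: cvg_unique gcK gq.
have : \sum_(i <- r) `|t i - s i| ^+ 2 == 0.
  have /eqP := lim_c F FF s ooF zs; rewrite (lim_c G FG t ooG zt) -subr_eq0 -sumrB.
  by under eq_bigr do rewrite -ipNl -ipDl -(normip ip_norm).
rewrite psumr_eq0 => [/allP h i ir|i _]; last exact: sqr_ge0.
by have := h i ir; rewrite sqrf_eq0 normr_eq0 subr_eq0 => /eqP.
Qed.

End Operators.

(** * Descent for the splitting iteration *)

(** The iteration after the substitution B_i = lam A_i, gam_i = beta_i / lam and
  p = n - f, with the element a_i of B_i chosen at each step as a variable. The
  inputs of the resolvents become the equations for z below, and the definition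
  of x_n becomes the balance sum_a. *)
Section Splitting.
Context (R : realType) (H : completeNormedModType R) (ip : {dot H for idfun})
  (ip_norm : induces_norm ip).
Context (n p : nat) (p_gt1 : (1 < p)%N) (p_le : (p <= n)%N).
Context (B : nat -> H -> set H) (gam : nat -> R) (theta : R).
Context (B_max : forall i, (1 <= i <= n)%N -> maximally_monotone ip (B i)).
Context (gam_gt0 : forall i, (p <= i < n)%N -> 0 < gam i).
Context (B_coco : forall i, (p <= i < n)%N -> forall x y u v,
  B i x u -> B i y v -> gam i * `|u - v| ^+ 2 <= ip (u - v) (x - y)).
Context (theta_gt0 : 0 < theta).
Context (param :
  2^-1 * (\sum_(p <= i < n) (gam i)^-1) < 2 - theta * (p - 1)%:R).
Context (x z a : nat -> nat -> H).
Context (aB1 : forall k, B 1%N (x 1%N k) (a 1%N k)).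
Context (z1E : forall k, z 1%N k = x 1%N k + a 1%N k).
Context (aBb : forall k i, (2 <= i < p)%N -> B i (x i k) (a i k)).
Context (zbE : forall k i, (2 <= i < p)%N ->
  z i k = a i k - theta *: (x 1%N k - x i k)).
Context (aBf : forall k i, (p <= i < n)%N -> B i (x 1%N k) (a i k)).
Context (aBn : forall k, B n (x n k) (a n k)).
Context (sum_a : forall k, \sum_(1 <= i < n.+1) a i k = x 1%N k - x n k).
Context (z_next : forall k i, (1 <= i < p)%N ->
  z i k.+1 = z i k - theta *: (x i k - x n k)).

(** A zero y of the sum, together with a decomposition of 0 that certifies it. *)
Definition primal_dual (y : H) (b : nat -> H) : Prop :=
  (forall i, (1 <= i <= n)%N -> B i y (b i)) /\ \sum_(1 <= i < n.+1) b i = 0.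

(** The value of the governing variable z that the iteration keeps fixed when all
  the x i are y and all the a i are b i. *)
Definition fixpt (y : H) (b : nat -> H) (i : nat) : H :=
  if i == 1%N then y + b i else b i.

Definition lyap (s : nat -> H) (k : nat) : R :=
  \sum_(1 <= i < p) `|z i k - s i| ^+ 2.

(** The guaranteed decrease per unit of squared residual of x_1 - x_n. *)
Definition rate : R :=
  theta * (2 - theta * (p - 1)%:R - 2^-1 * \sum_(p <= i < n) (gam i)^-1).

Lemma rate_gt0 : 0 < rate.
Proof. by rewrite mulr_gt0 // subr_gt0. Qed.

Lemma lyap_ge0 s k : 0 <= lyap s k.
Proof. by apply: sumr_ge0 => i _; rewrite sqr_ge0. Qed.

Lemma B_mono i y y' u v : (1 <= i <= n)%N -> B i y u -> B i y' v ->
  0 <= ip (u - v) (y - y').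
Proof. by move=> /B_max[mono _]; exact: mono. Qed.

Section Solution.
Context (y : H) (b : nat -> H) (yb : primal_dual y b).
Let s := fixpt y b.

(** The lemmas for the single operators have the common term
  2 theta <x_n - y, a_i - b_i>, which can only be evaluated after summing over
  all i, by the balance of the a_i. *)
Lemma descent_first k :
  `|z 1%N k.+1 - s 1%N| ^+ 2 - `|z 1%N k - s 1%N| ^+ 2 <=
  2 * theta * ip (x n k - y) (a 1%N k - b 1%N)
  - 2 * theta * ip (x 1%N k - x n k) (x 1%N k - y)
  + theta ^+ 2 * `|x 1%N k - x n k| ^+ 2.
Proof.
have i1 : (1 <= 1 <= n)%N by lia.
have mono := mulr_ge0 (ltW theta_gt0) (B_mono i1 (aB1 k) (yb.1 1%N i1)).
rewrite z_next ?z1E; last by lia.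
rewrite /s /fixpt eqxx.
have -> : x 1%N k - x n k = (x 1%N k - y) - (x n k - y) by rewrite opprB addrA subrK.
move: (x 1%N k) (x n k) (a 1%N k) (b 1%N) mono => x1 xn a1 b1.
have -> : x1 + a1 - theta *: (x1 - y - (xn - y)) - (y + b1) =
    (x1 - y) + (a1 - b1) - theta *: ((x1 - y) - (xn - y)).
  by rewrite (addrAC (x1 + a1)) opprD addrACA.
have -> : x1 + a1 - (y + b1) = (x1 - y) + (a1 - b1) by rewrite opprD addrACA.
move: (x1 - y) (a1 - b1) (xn - y) => P c N.
rewrite !(normip ip_norm) !ipE (ipC ip P c) (ipC ip N c) (ipC ip N P); lra.
Qed.

(** The cross term between the residual x_i - x_n and the correction x_1 - x_i is
  turned into squares by
  2 <x_i - x_n, x_1 - x_i> + |x_i - x_n|^2 = |x_1 - x_n|^2 - |x_1 - x_i|^2. *)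
Lemma descent_backward k i : (2 <= i < p)%N ->
  `|z i k.+1 - s i| ^+ 2 - `|z i k - s i| ^+ 2 <=
  2 * theta * ip (x n k - y) (a i k - b i)
  + theta ^+ 2 * `|x 1%N k - x n k| ^+ 2
  - theta ^+ 2 * `|x 1%N k - x i k| ^+ 2.
Proof.
move=> i_rng; have i1 : (1 <= i <= n)%N by lia.
have mono := mulr_ge0 (ltW theta_gt0) (B_mono i1 (aBb k i_rng) (yb.1 i i1)).
rewrite z_next ?zbE //; last by lia.
have -> : s i = b i by rewrite /s /fixpt ifF //; lia.
have shift u v : u - v = (u - y) - (v - y) by rewrite opprB addrA subrK.
rewrite (shift (x 1%N k) (x n k)) (shift (x 1%N k) (x i k)) (shift (x i k) (x n k)).
rewrite !(addrAC _ _ (- b i)).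
move: (x 1%N k - y) (x i k - y) (x n k - y) (a i k - b i) mono => P Q N c mono.
rewrite !(normip ip_norm) !ipE (ipC ip P c) (ipC ip N c) (ipC ip Q c)
  (ipC ip N P) (ipC ip Q P) (ipC ip N Q); rewrite ?ipE in mono; lra.
Qed.

(** Here the operator is evaluated at x_1 instead of x_n; the error
  <x_1 - x_n, a_i - b_i> is absorbed by the cocoercivity bound
  gam |a_i - b_i|^2 after completing the square. *)
Lemma descent_forward k i : (p <= i < n)%N ->
  0 <= 2 * theta * ip (x n k - y) (a i k - b i)
       + theta * 2^-1 * (gam i)^-1 * `|x 1%N k - x n k| ^+ 2.
Proof.
move=> i_rng; have i1 : (1 <= i <= n)%N by lia.
have coco := B_coco i_rng (aBf k i_rng) (yb.1 i i1); have g0 := gam_gt0 i_rng.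
have -> : x 1%N k - x n k = (x 1%N k - y) - (x n k - y) by rewrite opprB addrA subrK.
move: (x 1%N k - y) (x n k - y) (a i k - b i) coco => P N c coco.
have sq := ip_ge0 ip_norm ((P - N) - (2 * gam i) *: c).
have -> : 2 * theta * ip N c + theta / 2 / gam i * `|P - N| ^+ 2 =
    2 * theta * (ip c P - gam i * `|c| ^+ 2) + theta / (2 * gam i) *
    ip (P - N - (2 * gam i) *: c) (P - N - (2 * gam i) *: c).
  rewrite !(normip ip_norm) !ipE (ipC ip P c) (ipC ip N c) (ipC ip N P).
  by field; rewrite gt_eqF.
rewrite addr_ge0 ?mulr_ge0 ?invr_ge0 ?subr_ge0 ?mulr_ge0 ?(ltW theta_gt0) ?(ltW g0) //.
Qed.

Lemma descent_last k : 0 <= 2 * theta * ip (x n k - y) (a n k - b n).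
Proof.
have i1 : (1 <= n <= n)%N by lia.
rewrite mulr_ge0 ?mulr_ge0 ?(ltW theta_gt0) // ipC.
exact: B_mono i1 (aBn k) (yb.1 n i1).
Qed.

(** Since the a_i - b_i add up to x_1 - x_n, the common terms sum to
  2 theta <x_n - y, x_1 - x_n>, which together with the term of [descent_first]
  gives -2 theta |x_1 - x_n|^2. *)
Lemma descent k :
  rate * `|x 1%N k - x n k| ^+ 2
  + theta ^+ 2 * \sum_(2 <= i < p) `|x 1%N k - x i k| ^+ 2
  <= lyap s k - lyap s k.+1.
Proof.
set d := `|x 1%N k - x n k| ^+ 2.
pose g i := 2 * theta * ip (x n k - y) (a i k - b i).
have sum_g : \sum_(1 <= i < n.+1) g i =
    2 * theta * ip (x n k - y) (x 1%N k - x n k).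
  by rewrite -mulr_sumr -ip_sumr sumrB sum_a yb.2 subr0.
have split_g : \sum_(1 <= i < n.+1) g i = g 1%N + \sum_(2 <= i < p) g i
    + \sum_(p <= i < n) g i + g n.
  rewrite big_nat_recr /=; last by lia.
  rewrite (big_cat_nat (n := p)) /=; [|lia|lia].
  by rewrite big_ltn.
have Sback : \sum_(2 <= i < p) (`|z i k.+1 - s i| ^+ 2 - `|z i k - s i| ^+ 2) <=
    \sum_(2 <= i < p) g i + theta ^+ 2 * (p - 2)%:R * d
    - theta ^+ 2 * \sum_(2 <= i < p) `|x 1%N k - x i k| ^+ 2.
  have -> : theta ^+ 2 * (p - 2)%:R * d = \sum_(2 <= i < p) theta ^+ 2 * d.
    by rewrite big_const_nat iter_addr_0 -mulr_natr; ring.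
  rewrite mulr_sumr -big_split -sumrB /= !big_nat.
  by apply: ler_sum => i i_rng; exact: descent_backward.
have Sfwd : 0 <= \sum_(p <= i < n) g i
    + theta * 2^-1 * (\sum_(p <= i < n) (gam i)^-1) * d.
  rewrite mulr_sumr mulr_suml -big_split big_nat /=.
  by apply: sumr_ge0 => i i_rng; exact: descent_forward.
have S1 := descent_first k; have Sn := descent_last k.
have p1 : (p - 1)%:R = (p - 2)%:R + 1 :> R by rewrite natr1; congr _%:R; lia.
have dE : ip (x n k - y) (x 1%N k - x n k) =
    ip (x 1%N k - x n k) (x 1%N k - y) - d.
  rewrite /d; have -> : x n k - y = (x 1%N k - y) - (x 1%N k - x n k).
    by rewrite opprB [RHS]addrC addrA subrK.
  move: (x 1%N k - y) (x 1%N k - x n k) => P Q.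
  by rewrite (normip ip_norm) !ipE (ipC ip P).
rewrite -/d in S1; rewrite sumrB in Sback.
rewrite /lyap !(@big_ltn _ _ _ 1 p) // /rate p1.
rewrite split_g dE in sum_g; rewrite -/(g 1%N) in S1; rewrite -/(g n) in Sn.
lra.
Qed.


(** * Vanishing residuals and bounded iterates *)

Lemma lyap_nonincreasing k : lyap s k.+1 <= lyap s k.
Proof.
rewrite -subr_ge0; apply: le_trans (descent k).
apply: addr_ge0; first exact: mulr_ge0 (ltW rate_gt0) (sqr_ge0 _).
by apply: mulr_ge0; [exact: sqr_ge0 | apply: sumr_ge0 => i _; exact: sqr_ge0].
Qed.

Lemma lyap_homo : {homo lyap s : k l / (k <= l)%N >-> l <= k}.
Proof.
by apply: (@homo_leq _ _ (fun u v => v <= u)) => [//|u v w vu wv|k];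
  [exact: le_trans wv vu | exact: lyap_nonincreasing].
Qed.

Lemma lyap_cvg : cvgn (lyap s).
Proof.
apply: nonincreasing_is_cvgn; first exact: lyap_homo.
by exists 0 => _ [k _ <-]; exact: lyap_ge0.
Qed.

Lemma lyap_diff_cvg0 : lyap s k - lyap s k.+1 @[k --> \oo] --> (0 : R).
Proof.
have /cvg_ex[l sl] := lyap_cvg.
rewrite -(subrr l); apply: cvgB => //.
by move/(cvg_comp _ _ (cvg_addnr 1)): sl; under eq_fun do rewrite /= addn1.
Qed.

(** The Lyapunov values are nonnegative and nonincreasing, so their decreases tend
  to 0 and are bounded by the first value. *)
Lemma dominated_cvg0 (u : nat -> H) (c : R) : 0 < c ->
  (forall k, c * `|u k| ^+ 2 <= lyap s k - lyap s k.+1) ->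
  u k @[k --> \oo] --> (0 : H) /\ bounded_seq u.
Proof.
move=> c0 uc; split; last first.
  apply: (@bounded_seq_sqr _ _ (c^-1 * lyap s 0)) => k.
  rewrite ler_pdivlMl //; apply: le_trans (uc k) _.
  have := lyap_homo (leq0n k); have := lyap_ge0 s k.+1; lra.
have sq0 : `|u k| ^+ 2 @[k --> \oo] --> (0 : R).
  apply: (@cvg_bound0 _ _ _ _ _ (fun k => lyap s k - lyap s k.+1) c^-1).
    by move=> k; rewrite ger0_norm ?sqr_ge0 // ler_pdivlMl.
  exact: lyap_diff_cvg0.
apply/cvgr0Pnorm_lt => e e0.
have [N _ NP] := cvgr0_norm_lt _ sq0 _ (exprn_gt0 2 e0).
exists N => // k /NP /=.
by rewrite ger0_norm ?sqr_ge0 // ltr_sqr ?nnegrE ?(ltW e0).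
Qed.

Lemma residual_last : x 1%N k - x n k @[k --> \oo] --> (0 : H) /\
  bounded_seq (fun k => x 1%N k - x n k).
Proof.
apply: (dominated_cvg0 rate_gt0) => k; apply: le_trans (descent k).
by rewrite lerDl mulr_ge0 ?sqr_ge0 // sumr_ge0 // => i _; exact: sqr_ge0.
Qed.

Lemma residual_backward i : (2 <= i < p)%N ->
  x 1%N k - x i k @[k --> \oo] --> (0 : H) /\
  bounded_seq (fun k => x 1%N k - x i k).
Proof.
move=> i_rng; apply: (dominated_cvg0 (exprn_gt0 2 theta_gt0)) => k.
apply: le_trans (descent k).
rewrite ler_wpDl //; first exact: mulr_ge0 (ltW rate_gt0) (sqr_ge0 _).
rewrite ler_wpM2l ?sqr_ge0 // (big_cat_nat (n := i)) /=; [|lia|lia].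
rewrite (@big_ltn _ _ _ i); last by lia.
by rewrite addrCA lerDl addr_ge0 // sumr_ge0 // => j _; exact: sqr_ge0.
Qed.

Lemma z_bounded i : (1 <= i < p)%N -> bounded_seq (z i).
Proof.
move=> i_rng; have -> : z i = fun k => (z i k - s i) + s i.
  by apply/funext => k; rewrite subrK.
apply: bounded_seqD; last exact: bounded_seq_cst.
apply: (@bounded_seq_sqr _ _ (lyap s 0)) => k.
apply: le_trans (lyap_homo (leq0n k)).
rewrite /lyap (big_cat_nat (n := i)) /=; [|lia|lia].
rewrite (@big_ltn _ _ _ i); last by lia.
by rewrite addrCA lerDl addr_ge0 // sumr_ge0 // => j _; exact: sqr_ge0.
Qed.

(** Resolvents are nonexpansive, and x_1 - y is the difference of the values of
  that of B_1 at z_1 and at its fixed point. *)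
Lemma x1_bounded : bounded_seq (x 1%N).
Proof.
have [M zM] : bounded_seq (fun k => z 1%N k - s 1%N).
  by apply: bounded_seqB (bounded_seq_cst _); apply: z_bounded; lia.
have -> : x 1%N = fun k => (x 1%N k - y) + y.
  by apply/funext => k; rewrite subrK.
apply: bounded_seqD (bounded_seq_cst _); exists M => k.
apply: le_trans (zM k).
have i1 : (1 <= 1 <= n)%N by lia.
have mono := B_mono i1 (aB1 k) (yb.1 1%N i1).
have -> : z 1%N k - s 1%N = (x 1%N k - y) + (a 1%N k - b 1%N).
  by rewrite z1E /s /fixpt eqxx opprD addrACA.
move: (x 1%N k - y) (a 1%N k - b 1%N) mono => P c mono.
have [->|P0] := eqVneq P 0; first by rewrite normr0.
have := ip_le ip_norm P (P + c).
rewrite ipDr -(normip ip_norm) (ipC ip P c) => h.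
have P1 : 0 < `|P| by rewrite normr_gt0.
by rewrite -(ler_pM2l P1) -expr2; lra.
Qed.

(** For i < p the a_i are read off from z and the residuals, for the forward steps
  cocoercivity makes B_i Lipschitz, and a_n is determined by the balance. *)
Lemma a_bounded i : (1 <= i <= n)%N -> bounded_seq (a i).
Proof.
have lt_n j : (1 <= j < n)%N -> bounded_seq (a j).
  move=> jn; have [->|j1] := eqVneq j 1%N.
    have -> : a 1%N = fun k => z 1%N k - x 1%N k.
      by apply/funext => k; rewrite z1E addrAC subrr add0r.
    by apply: bounded_seqB x1_bounded; apply: z_bounded; lia.
  have [jp|pj] := ltnP j p.
    have j2 : (2 <= j < p)%N by lia.
    have -> : a j = fun k => z j k + theta *: (x 1%N k - x j k).
      by apply/funext => k; rewrite zbE // subrK.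
    apply: bounded_seqD; first by apply: z_bounded; lia.
    by apply: bounded_seqZ; have [] := residual_backward j2.
  have pjn : (p <= j < n)%N by lia.
  have -> : a j = fun k => (a j k - b j) + b j.
    by apply/funext => k; rewrite subrK.
  apply: bounded_seqD (bounded_seq_cst _).
  have [M xM] : bounded_seq (fun k => (gam j)^-1 *: (x 1%N k - y)).
    by apply: bounded_seqZ; apply: bounded_seqB x1_bounded (bounded_seq_cst _).
  exists M => k; apply: le_trans (xM k).
  have j1n : (1 <= j <= n)%N by lia.
  have g0 := gam_gt0 pjn; have := B_coco pjn (aBf k pjn) (yb.1 j j1n).
  rewrite normrZ gtr0_norm ?invr_gt0 //.
  move: (x 1%N k - y) (a j k - b j) => P c coco.
  have [->|c0] := eqVneq c 0; first by rewrite normr0 mulr_ge0 ?invr_ge0 ?(ltW g0).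
  have c1 : 0 < `|c| by rewrite normr_gt0.
  rewrite ler_pdivlMl // -(ler_pM2l c1) mulrCA -expr2.
  exact: le_trans coco (ip_le ip_norm _ _).
move=> /andP[i1]; rewrite leq_eqVlt => /orP[/eqP ->|lt_in]; last first.
  by apply: lt_n; rewrite i1.
have -> : a n = fun k => (x 1%N k - x n k) - \sum_(1 <= j < n) a j k.
  apply/funext => k; rewrite -sum_a big_nat_recr /=; last by lia.
  by rewrite addrAC subrr add0r.
apply: bounded_seqB; first by have [] := residual_last.
by apply: bounded_seq_sum => j; rewrite mem_index_iota; exact: lt_n.
Qed.

End Solution.

(** * Weak convergence *)

Lemma ultra_limit_primal_dual (y0 : H) (b0 : nat -> H) (U : set_system nat)
    (UU : UltraFilter U) : primal_dual y0 b0 -> \oo `<=` U ->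
  exists y b, [/\ primal_dual y b, weak_cvg_along ip U (x 1%N) y &
    forall i, (1 <= i <= n)%N -> weak_cvg_along ip U (a i) (b i)].
Proof.
move=> sol ooU; have UP : ProperFilter U := @ultra_proper _ U UU.
have [y xy] := ultra_bounded_weak_cvg ip_norm UU (x1_bounded sol).
have /choice[b ab] : forall i, exists b, (1 <= i <= n)%N ->
    weak_cvg_along ip U (a i) b.
  move=> i; have [i1|_] := boolP (1 <= i <= n)%N; last by exists 0.
  by have [b ab] := ultra_bounded_weak_cvg ip_norm UU (a_bounded sol i1); exists b.
exists y, b; split=> //.
(* the point at which B i is evaluated *)
pose w i := if (p <= i < n)%N then x 1%N else x i.
have lower (u : nat -> H) : u k @[k --> \oo] --> (0 : H) -> u k @[k --> U] --> (0 : H).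
  by move=> u0 S S0; apply: ooU; exact: u0.
have self0 : x 1%N k - x 1%N k @[k --> U] --> (0 : H).
  have -> : (fun k => x 1%N k - x 1%N k) = fun=> 0 by apply/funext => k; rewrite subrr.
  exact: cvg_cst.
have [Bb b_sum] : (forall i, i \in index_iota 1 n.+1 -> B i y (b i)) /\
    \sum_(i <- index_iota 1 n.+1) b i = 0.
  apply: (@demiclosed_sum _ _ _ ip_norm U UP _ _ B w a (x 1%N)).
  - by move=> i; rewrite mem_index_iota; exact: B_max.
  - move=> i k; rewrite mem_index_iota /w => i1.
    case: ifPn => i_rng; first exact: aBf.
    have [->|i1'] := eqVneq i 1%N; first exact: aB1.
    have [->|iN] := eqVneq i n; first exact: aBn.
    by apply: aBb; lia.
  - by move=> i; rewrite mem_index_iota; exact: a_bounded sol _.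
  - exact: x1_bounded sol.
  - move=> i; rewrite mem_index_iota /w => i1; case: ifPn => i_rng; first exact: self0.
    have [->|i1'] := eqVneq i 1%N; first exact: self0.
    under eq_fun do rewrite -opprB.
    rewrite -oppr0; apply: cvgN; apply: lower.
    have [->|iN] := eqVneq i n; first by have [] := residual_last sol.
    have i2 : (2 <= i < p)%N by lia.
    by have [] := residual_backward sol i2.
  - under eq_fun do rewrite sum_a.
    by apply: lower; have [] := residual_last sol.
  - exact: xy.
  - by move=> i; rewrite mem_index_iota; exact: ab.
by split=> // i i1; apply: Bb; rewrite mem_index_iota.
Qed.

(** Opial's argument applies to the governing variables z, whose distances to the
  fixed points converge; y is recovered from the fixed point because B_1 is
  monotone, so that y + b_1 determines y. *)
Lemma ultra_limit_unique (U V : set_system nat) (UU : UltraFilter U)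
    (VV : UltraFilter V) (y y' : H) (b b' : nat -> H) :
  \oo `<=` U -> \oo `<=` V -> primal_dual y b -> primal_dual y' b' ->
  weak_cvg_along ip U (x 1%N) y -> weak_cvg_along ip V (x 1%N) y' ->
  (forall i, (1 <= i <= n)%N -> weak_cvg_along ip U (a i) (b i)) ->
  (forall i, (1 <= i <= n)%N -> weak_cvg_along ip V (a i) (b' i)) ->
  y = y'.
Proof.
move=> ooU ooV sol sol' xy xy' ab ab'.
have z_lim W (WW : UltraFilter W) (q : H) (c : nat -> H) :
    \oo `<=` W -> primal_dual q c -> weak_cvg_along ip W (x 1%N) q ->
    (forall i, (1 <= i <= n)%N -> weak_cvg_along ip W (a i) (c i)) ->
    forall i, i \in index_iota 1 p -> weak_cvg_along ip W (z i) (fixpt q c i).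
  move=> ooW solW xq ac i; rewrite mem_index_iota => i1 v.
  have WP : ProperFilter W := @ultra_proper _ W WW.
  have i1n : (1 <= i <= n)%N by lia.
  rewrite /fixpt; have [->|i1'] := eqVneq i 1%N.
    under eq_fun do rewrite z1E ipDl.
    by rewrite ipDl; apply: cvgD; [exact: xq | apply: ac; lia].
  have i2 : (2 <= i < p)%N by lia.
  under eq_fun do rewrite zbE // ipDl ipNl ipZl.
  have -> : ip (c i) v = ip (c i) v - theta * 0 by rewrite mulr0 subr0.
  apply: cvgB; first exact: ac.
  apply: cvgMl_tmp; rewrite -(ip0l ip v); apply: cvg_ipl => // S S0.
  by apply: ooW; have [res _] := residual_backward solW i2; exact: res.
have UP : ProperFilter U := @ultra_proper _ U UU.
have VP : ProperFilter V := @ultra_proper _ V VV.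
have s_eq : fixpt y b 1%N = fixpt y' b' 1%N.
  apply: (opial_uniqueness ip_norm ooU ooV (lyap_cvg sol) (lyap_cvg sol')
    (z_lim U UU y b ooU sol xy ab) (z_lim V VV y' b' ooV sol' xy' ab')).
  by rewrite mem_index_iota; lia.
rewrite /fixpt eqxx in s_eq.
have i1 : (1 <= 1 <= n)%N by lia.
have := B_mono i1 (sol.1 _ i1) (sol'.1 _ i1).
have -> : b 1%N - b' 1%N = - (y - y').
  apply/eqP; rewrite -subr_eq0 opprK addrC addrACA -opprD s_eq subrr //.
by rewrite ipNl oppr_ge0; exact: ip_self_inj.
Qed.

(** The limit obtained along one ultrafilter is the limit along all of them, hence
  along the tails. *)
Theorem splitting_weak_cvg : (exists y b, primal_dual y b) ->
  exists y, (exists b, primal_dual y b) /\ weakly_cvg ip (x n) y.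
Proof.
move=> [y0 [b0 sol0]].
have [U [UU ooU]] := ultraFilterLemma (@eventually_filter).
have [y [b [sol xy ab]]] := ultra_limit_primal_dual UU sol0 ooU.
exists y; split; first by exists b.
move=> v; apply: cvg_ultra => V VV ooV.
have VP : ProperFilter V := @ultra_proper _ V VV.
have [y' [b' [sol' xy' ab']]] := ultra_limit_primal_dual VV sol0 ooV.
have yy' := ultra_limit_unique UU VV ooU ooV sol sol' xy xy' ab ab'.
have xE k : ip (x n k) v = ip (x 1%N k) v - ip (x 1%N k - x n k) v.
  by rewrite -ipNl -ipDl opprB addrC subrK.
under eq_fun do rewrite xE.
rewrite yy' -[ip y' v]subr0; apply: cvgB; first exact: xy'.
rewrite -(ip0l ip v); apply: cvg_ipl => // S S0.
by apply: ooV; have [res _] := residual_last sol; exact: res.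
Qed.

End Splitting.

(** * The iteration for the original operators *)

Section Scaling.
Context (R : realType) (H : completeNormedModType R) (ip : {dot H for idfun}).

Lemma scaleopE (c : R) (A : H -> set H) (x v : H) : c != 0 ->
  scaleop c A x v <-> A x (c^-1 *: v).
Proof.
move=> c0; split=> [[u Au <-]|Av]; first by rewrite scalerA mulVf // scale1r.
by exists (c^-1 *: v) => //; rewrite scalerA divff // scale1r.
Qed.

Lemma scaleop_maximally_monotone (c : R) (A : H -> set H) : 0 < c ->
  maximally_monotone ip A -> maximally_monotone ip (scaleop c A).
Proof.
move=> c0 Amax; have c1 : c != 0 by rewrite gt_eqF.
split=> [x y u v /(scaleopE _ _ _ c1) Au /(scaleopE _ _ _ c1) Av|C Cmono AC x v Cxv].
  have := Amax.1 _ _ _ _ Au Av.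
  by rewrite -scalerBr ipZl pmulr_rge0 ?invr_gt0.
apply/(scaleopE _ _ _ c1); apply: (maximally_monotone_in Amax) => y w Ayw.
have Cyw : C y (c *: w) by apply: AC; exists w.
have := Cmono _ _ _ _ Cxv Cyw; rewrite -(pmulr_rge0 _ (_ : 0 < c^-1)) ?invr_gt0 //.
by rewrite -ipZl scalerBr scalerA mulVf // scale1r.
Qed.

Lemma scaleop_cocoercive (c beta : R) (A : H -> set H) (x y u v : H) : 0 < c ->
  cocoercive ip beta A -> scaleop c A x u -> scaleop c A y v ->
  beta / c * `|u - v| ^+ 2 <= ip (u - v) (x - y).
Proof.
move=> c0 [_ coco] [u' Au <-] [v' Av <-].
rewrite -scalerBr ipZl normrZ gtr0_norm // exprMn.
have -> : beta / c * (c ^+ 2 * `|u' - v'| ^+ 2) = c * (beta * `|u' - v'| ^+ 2).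
  by field; rewrite gt_eqF.
by rewrite ler_pM2l //; exact: coco.
Qed.

Lemma resolvent_value (A : H -> set H) (x y : H) :
  is_value (resolvent A) y x -> A x (y - x).
Proof.
move=> Axy; have : resolvent A y x by rewrite Axy.
by move=> [u Axu <-]; rewrite addrC addKr.
Qed.

End Scaling.

Theorem theorem8p1 (R : realType) (H : completeNormedModType R)
    (ip : {dot H for idfun}) (ip_norm : induces_norm ip) (dimH : dim_ge2 H)
    (n f : nat) (n_ge2 : (2 <= n)%N) (f_le : (f <= n - 2)%N)
    (A : nat -> H -> set H) (A_class : class_AnF ip n (indexF n f) A)
    (lam theta : R) (lam_gt0 : 0 < lam) (theta_gt0 : 0 < theta)
    (z x : nat -> nat -> H) (xbar : nat -> H)
    (x_first : forall k, is_value (resolvent (scaleop lam (A 1%N))) (z 1%N k) (x 1%N k))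
    (x_backward : forall k i, (2 <= i <= n - 1 - f)%N ->
      is_value (resolvent (scaleop (theta^-1 * lam) (A i)))
               (x 1%N k + theta^-1 *: z i k) (x i k))
    (x_forward : forall k i, (n - f <= i <= n - 1)%N ->
      is_value (scaleop lam (A i)) (x 1%N k) (x i k))
    (xbar_def : forall k,
      xbar k = \sum_(n - f <= j < n) x j k +
               \sum_(2 <= j < n - f) (z j k + theta *: (x 1%N k - x j k)))
    (x_last : forall k,
      is_value (resolvent (scaleop lam (A n)))
               (2 *: x 1%N k - z 1%N k - xbar k) (x n k))
    (z_next : forall k i, (1 <= i <= n - 1 - f)%N ->
      z i k.+1 = z i k - theta *: (x i k - x n k))
    (zer_nonempty : zer (sumop n A) !=set0)
    (beta : nat -> R)
    (A_coco : forall i, indexF n f i -> 0 < beta i /\ cocoercive ip (beta i) (A i))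
    (param : lam / 2 * (\sum_(n - f <= i < n) (beta i)^-1)
             < 2 - theta * (n - 1 - f)%:R) :
  exists xstar : H, zer (sumop n A) xstar /\ weakly_cvg ip (x n) xstar.
Proof.
have lam0 : lam != 0 by rewrite gt_eqF.
have theta0 : theta != 0 by rewrite gt_eqF.
set p := (n - f)%N in param xbar_def x_forward.
have p_gt1 : (1 < p)%N by lia.
have p_le : (p <= n)%N by lia.
pose B i := scaleop lam (A i).
have inF i : (p <= i < n)%N -> indexF n f i.
  by move=> i1; rewrite /indexF ifT /=; lia.
have zer_primal_dualP y : zer (sumop n A) y <-> exists b, primal_dual n B y b.
  split=> [[u [Au /esym u0]]|[b [Bb b0]]].
    exists (fun i => lam *: u i); split.
      by move=> i i1; exists (u i); [exact: Au|].
    by rewrite -scaler_sumr u0 scaler0.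
  exists (fun i => lam^-1 *: b i); split; last by rewrite -scaler_sumr b0 scaler0.
  by move=> i i1; apply/(scaleopE _ _ _ lam0); exact: Bb.
(* the element of lam A_i that step k selects, read off from the argument of the
   resolvent *)
pose a i k := if i == 1%N then z 1%N k - x 1%N k else
  if (i < p)%N then z i k + theta *: (x 1%N k - x i k) else
  if (i < n)%N then x i k else 2 *: x 1%N k - z 1%N k - xbar k - x n k.
have a1E k : a 1%N k = z 1%N k - x 1%N k by rewrite /a eqxx.
have abE k i : (2 <= i < p)%N -> a i k = z i k + theta *: (x 1%N k - x i k).
  by move=> i2; rewrite /a ifF; [rewrite ifT; [|lia] | lia].
have afE k i : (p <= i < n)%N -> a i k = x i k.
  by move=> i2; rewrite /a; do 2 (rewrite ifF; last by lia); rewrite ifT; last by lia.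
have anE k : a n k = 2 *: x 1%N k - z 1%N k - xbar k - x n k.
  by rewrite /a; do 3 (rewrite ifF; last by lia).
have [y [yb xy]] : exists y, (exists b, primal_dual n B y b) /\ weakly_cvg ip (x n) y.
  apply: (@splitting_weak_cvg R H ip ip_norm n p p_gt1 p_le B
    (fun i => beta i / lam) theta _ _ _ theta_gt0 _ x z a).
  - by move=> i /A_class.1 Amax; exact: scaleop_maximally_monotone.
  - by move=> i /inF /A_coco[beta0 _]; rewrite divr_gt0.
  - by move=> i /inF /A_coco[_ coco] x1 x2 u v; exact: scaleop_cocoercive.
  - under eq_bigr do rewrite invf_div.
    rewrite -mulr_sumr mulrA (mulrC _ lam).
    by have -> : (p - 1 = n - 1 - f)%N by lia.
  - by move=> k; rewrite a1E; exact: resolvent_value.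
  - by move=> k; rewrite a1E addrC subrK.
  - move=> k i i2; rewrite abE //; apply/(scaleopE _ _ _ lam0).
    have i2' : (2 <= i <= n - 1 - f)%N by lia.
    have := resolvent_value (x_backward k i i2').
    have tl0 : theta^-1 * lam != 0 by rewrite mulf_neq0 ?invr_eq0.
    move/(scaleopE _ _ _ tl0); rewrite invfM invrK.
    congr (A i _ _); rewrite mulrC -scalerA; congr (_ *: _).
    by rewrite addrAC scalerDr scalerA divff // scale1r [LHS]addrC.
  - by move=> k i i2; rewrite abE // addrK.
  - by move=> k i i2; rewrite afE // /B x_forward //; lia.
  - by move=> k; rewrite anE; exact: resolvent_value.
  - move=> k; rewrite big_nat_recr /=; last by lia.
    rewrite (big_cat_nat (n := p)) /=; [|lia|lia].
    rewrite big_ltn // a1E anE xbar_def.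
    rewrite (eq_big_nat _ _ (abE k)) (eq_big_nat _ _ (afE k)).
    move: (\sum_(2 <= j < p) _) (\sum_(p <= j < n) _) => S T.
    have -> : 2 *: x 1%N k - z 1%N k - (T + S) - x n k =
        (x 1%N k - x n k) - (z 1%N k - x 1%N k + S + T).
      rewrite scaler_nat mulr2n !opprD opprK !addrA.
      by rewrite [RHS](ACl (1*4*3*6*5*2)).
    by rewrite addrC subrK.
  - by move=> k i i1; apply: z_next; lia.
  - by case: zer_nonempty => y /zer_primal_dualP yb; exists y.
by exists y; split => //; apply/zer_primal_dualP.
Qed.
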